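(* Let $F\dashv G\dashv H:\mathcal{C}\to\mathcal{D}$ be an adjoint triple, i.e. $F,H:\mathcal{C}\to\mathcal{D}$ and $G:\mathcal{D}\to\mathcal{C}$ are functors with $F\dashv G$ and $G\dashv H$. Then $F$ is semiseparable (resp. separable, naturally full) if and only if so is $H$.
   Context: For a functor $F:\mathcal{C}\to\mathcal{D}$ let $\mathcal{F}^F:\mathrm{Hom}_{\mathcal{C}}(-,-)\to\mathrm{Hom}_{\mathcal{D}}(F-,F-)$ be the natural transformation (of functors $\mathcal{C}^{\mathrm{op}}\times\mathcal{C}\to\mathsf{Set}$) with $\mathcal{F}^F_{X,Y}(f)=F(f)$. $F$ is separable if there is a natural transformation $\mathcal{P}^F:\mathrm{Hom}_{\mathcal{D}}(F-,F-)\to\mathrm{Hom}_{\mathcal{C}}(-,-)$ with $\mathcal{P}^F\circ\mathcal{F}^F=\mathrm{Id}$; naturally full if there is such a $\mathcal{P}^F$ with $\mathcal{F}^F\circ\mathcal{P}^F=\mathrm{Id}$; semiseparable if there is such a $\mathcal{P}^F$ with $\mathcal{F}^F\circ\mathcal{P}^F\circ\mathcal{F}^F=\mathcal{F}^F$. *)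

(* Defs.v *)
From Stdlib Require Import FunctionalExtensionality ProofIrrelevance.

Set Implicit Arguments.
Unset Strict Implicit.
Unset Printing Implicit Defensive.

Record Category := {
  Ob :> Type;
  Hom : Ob -> Ob -> Type;
  idm : forall X : Ob, Hom X X;
  comp : forall X Y Z : Ob, Hom Y Z -> Hom X Y -> Hom X Z;
  comp_idl : forall (X Y : Ob) (f : Hom X Y), comp (idm Y) f = f;
  comp_idr : forall (X Y : Ob) (f : Hom X Y), comp f (idm X) = f;
  comp_assoc : forall (W X Y Z : Ob) (h : Hom Y Z) (g : Hom X Y) (f : Hom W X),
    comp h (comp g f) = comp (comp h g) f
}.

Arguments Hom {c} _ _.
Arguments idm {c} _.
Arguments comp {c X Y Z} _ _.

Notation "g \c f" := (comp g f) (at level 40, left associativity).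

Record Functor (C D : Category) := {
  fobj :> C -> D;
  fmap : forall X Y : C, Hom X Y -> Hom (fobj X) (fobj Y);
  fmap_id : forall X : C, fmap (idm X) = idm (fobj X);
  fmap_comp : forall (X Y Z : C) (g : Hom Y Z) (f : Hom X Y),
    fmap (g \c f) = fmap g \c fmap f
}.

Arguments fmap {C D} _ {X Y} _.

Record NatTrans (C D : Category) (F G : Functor C D) := {
  component :> forall X : C, Hom (F X) (G X);
  naturality : forall (X Y : C) (f : Hom X Y),
    component Y \c fmap F f = fmap G f \c component X
}.

Lemma nat_trans_eq (C D : Category) (F G : Functor C D) (a b : NatTrans F G) :
  (forall X : C, a X = b X) -> a = b.
Proof.
destruct a as [a na], b as [b nb]; simpl; intros e.
assert (E : a = b) by (apply functional_extensionality_dep; exact e).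
subst b; f_equal; apply proof_irrelevance.
Qed.

Definition idF (C : Category) : Functor C C.
Proof.
refine {| fobj := fun X : C => X; fmap := fun X Y f => f |}; reflexivity.
Defined.

Definition compF (C D E : Category) (G : Functor D E) (F : Functor C D) :
  Functor C E.
Proof.
refine {| fobj := fun X : C => G (F X);
          fmap := fun X Y f => fmap G (fmap F f) |}.
- intros X; rewrite fmap_id; apply fmap_id.
- intros X Y Z g f; rewrite fmap_comp; apply fmap_comp.
Defined.

Definition idN (C D : Category) (F : Functor C D) : NatTrans F F.
Proof.
refine {| component := fun X : C => idm (F X) |}.
intros X Y f; rewrite comp_idl, comp_idr; reflexivity.
Defined.

Definition compN (C D : Category) (F G H : Functor C D)
  (b : NatTrans G H) (a : NatTrans F G) : NatTrans F H.
Proof.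
refine {| component := fun X : C => b X \c a X |}.
intros X Y f.
rewrite <- comp_assoc, naturality, comp_assoc, naturality, comp_assoc.
reflexivity.
Defined.

Notation "b \n a" := (compN b a) (at level 40, left associativity).

Definition opposite (C : Category) : Category.
Proof.
refine {| Ob := C;
          Hom := fun X Y : C => @Hom C Y X;
          idm := fun X : C => idm X;
          comp := fun X Y Z (g : @Hom C Z Y) (f : @Hom C Y X) => f \c g |}.
- intros X Y f; apply comp_idr.
- intros X Y f; apply comp_idl.
- intros W X Y Z h g f; symmetry; apply comp_assoc.
Defined.

Definition product (C D : Category) : Category.
Proof.
refine {| Ob := (C * D)%type;
          Hom := fun p q => (Hom (fst p) (fst q) * Hom (snd p) (snd q))%type;
          idm := fun p => (idm (fst p), idm (snd p));
          comp := fun p q r g f => (fst g \c fst f, snd g \c snd f) |}.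
- intros p q [f1 f2]; simpl; rewrite !comp_idl; reflexivity.
- intros p q [f1 f2]; simpl; rewrite !comp_idr; reflexivity.
- intros p q r s h g f; simpl; rewrite !comp_assoc; reflexivity.
Defined.

(* Types with Leibniz equality play the role of the sets of [Set]. *)
Definition SetCat : Category.
Proof.
refine {| Ob := Type;
          Hom := fun A B => A -> B;
          idm := fun A x => x;
          comp := fun A B C g f x => g (f x) |}; reflexivity.
Defined.

Definition oppositeF (C D : Category) (F : Functor C D) :
  Functor (opposite C) (opposite D).
Proof.
refine (@Build_Functor (opposite C) (opposite D) (fun X : C => F X)
          (fun X Y (f : @Hom C Y X) => fmap F f) _ _).
- intros X; apply (fmap_id F).
- intros X Y Z g f; apply (fmap_comp F).
Defined.

Definition productF (C C' D D' : Category)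
  (F : Functor C D) (F' : Functor C' D') :
  Functor (product C C') (product D D').
Proof.
refine (@Build_Functor (product C C') (product D D')
          (fun p => (F (fst p), F' (snd p)))
          (fun p q f => (fmap F (fst f), fmap F' (snd f))) _ _).
- intros p; simpl; rewrite !fmap_id; reflexivity.
- intros p q r g f; simpl; rewrite !fmap_comp; reflexivity.
Defined.

Definition HomF (C : Category) : Functor (product (opposite C) C) SetCat.
Proof.
refine (@Build_Functor (product (opposite C) C) SetCat
          (fun p => @Hom C (fst p) (snd p))
          (fun p q (u : @Hom C (fst q) (fst p) * @Hom C (snd p) (snd q))
               (f : @Hom C (fst p) (snd p)) => snd u \c f \c fst u) _ _).
- intros p; apply functional_extensionality; intros f; simpl.
  rewrite comp_idl, comp_idr; reflexivity.
- intros p q r g f; apply functional_extensionality; intros h; simpl.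
  rewrite !comp_assoc; reflexivity.
Defined.

(* On objects, (X, Y) is sent to [Hom (F X) (F Y)]. *)
Definition HomF_along (C D : Category) (F : Functor C D) :
  Functor (product (opposite C) C) SetCat :=
  compF (HomF D) (productF (oppositeF F) F).

Definition hom_action (C D : Category) (F : Functor C D) :
  NatTrans (HomF C) (HomF_along F).
Proof.
refine (@Build_NatTrans _ _ (HomF C) (HomF_along F)
          (fun p (f : @Hom C (fst p) (snd p)) => fmap F f) _).
intros p q u; apply functional_extensionality; intros f; simpl.
rewrite !fmap_comp; reflexivity.
Defined.

Definition separable (C D : Category) (F : Functor C D) : Prop :=
  exists P : NatTrans (HomF_along F) (HomF C),
    P \n hom_action F = idN (HomF C).

Definition naturally_full (C D : Category) (F : Functor C D) : Prop :=
  exists P : NatTrans (HomF_along F) (HomF C),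
    hom_action F \n P = idN (HomF_along F).

Definition semiseparable (C D : Category) (F : Functor C D) : Prop :=
  exists P : NatTrans (HomF_along F) (HomF C),
    hom_action F \n P \n hom_action F = hom_action F.

Record Adjunction (C D : Category) (F : Functor C D) (G : Functor D C) := {
  adj_unit : NatTrans (idF C) (compF G F);
  adj_counit : NatTrans (compF F G) (idF D);
  adj_triangle_left : forall X : C,
    adj_counit (F X) \c fmap F (adj_unit X) = idm (F X);
  adj_triangle_right : forall Y : D,
    fmap G (adj_counit Y) \c adj_unit (G Y) = idm (G Y)
}.

Notation "F -| G" := (Adjunction F G) (at level 70, no associativity).

(* Main.v *)
(** Let [e], [e'] be the units and [d], [d'] the counits of [F -| G -| H].  A
    natural family [p] on the hom-sets of [F] gives [nu = p d_F : GF -> 1], whose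
    mate [gamma = GH nu . G e'_F . e : 1 -> GH] satisfies [d' gamma = nu e], and
    [q g = d' . G g . gamma] is a natural family on the hom-sets of [H].  Since
    [p (F f) = f . nu e] and [q (H f) = f . d' gamma], the two families agree on
    the image of the hom-sets of [C], and an endomorphism of the identity functor
    sent to the identity by [F] is the identity on the image of [G], hence is
    sent to the identity by [H].
    If [F] maps [p g] to [g], then [e nu = 1], whence [gamma d' = 1] and [H] maps
    [q g] to [g].  This passes the three properties from [F] to [H]; the converse
    is the same statement for the opposite triple [H^op -| G^op -| F^op]. *)
From Stdlib Require Import FunctionalExtensionality Setoid.
Require Import Defs.

Set Implicit Arguments.
Unset Strict Implicit.
Unset Printing Implicit Defensive.

(** * The three properties as pointwise equations on families of maps *)

Definition hom_family (C D : Category) (F : Functor C D) : Type :=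
  forall X Y : C, Hom (F X) (F Y) -> Hom X Y.

Definition natural_family (C D : Category) (F : Functor C D)
  (p : hom_family F) : Prop :=
  forall (X X' Y Y' : C) (u : Hom X' X) (v : Hom Y Y') (g : Hom (F X) (F Y)),
    p X' Y' (fmap F v \c g \c fmap F u) = v \c p X Y g \c u.

Definition retracts (C D : Category) (F : Functor C D) (p : hom_family F) :
  Prop :=
  forall (X Y : C) (f : Hom X Y), p X Y (fmap F f) = f.

Definition sections (C D : Category) (F : Functor C D) (p : hom_family F) :
  Prop :=
  forall (X Y : C) (g : Hom (F X) (F Y)), fmap F (p X Y g) = g.

Definition regular (C D : Category) (F : Functor C D) (p : hom_family F) :
  Prop :=
  forall (X Y : C) (f : Hom X Y), fmap F (p X Y (fmap F f)) = fmap F f.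

Definition family_of (C D : Category) (F : Functor C D)
  (P : NatTrans (HomF_along F) (HomF C)) : hom_family F :=
  fun X Y => P (X, Y).

Lemma exists_natural_family (C D : Category) (F : Functor C D)
  (S : hom_family F -> Prop) :
  (exists P, S (family_of P)) <-> (exists p, natural_family p /\ S p).
Proof.
split.
- intros [P HS]; exists (family_of P); split; [|exact HS].
  intros X X' Y Y' u v g.
  exact (equal_f (@naturality _ _ _ _ P (X, Y) (X', Y') (u, v)) g).
- intros [p [np HS]].
  (* [family_of] of this transformation is convertible to [p], so [HS] applies as it stands. *)
  unshelve eexists (@Build_NatTrans _ _ (HomF_along F) (HomF C)
    (fun r => p (fst r) (snd r)) _); [|exact HS].
  intros [X Y] [X' Y'] [u v]; apply functional_extensionality; intros g.
  apply np.
Qed.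

Lemma set_nat_trans_eq (C : Category)
  (K L : Functor (product (opposite C) C) SetCat) (a b : NatTrans K L) :
  a = b <-> forall (X Y : C) (x : K (X, Y)), a (X, Y) x = b (X, Y) x.
Proof.
split; [intros -> X Y x; reflexivity|].
intros E; apply nat_trans_eq; intros [X Y].
apply functional_extensionality; apply E.
Qed.

Lemma separableE (C D : Category) (F : Functor C D) :
  separable F <-> exists p : hom_family F, natural_family p /\ retracts p.
Proof.
rewrite <- exists_natural_family.
split; intros [P HP]; exists P.
- exact (proj1 (set_nat_trans_eq _ _) HP).
- apply set_nat_trans_eq; exact HP.
Qed.

Lemma naturally_fullE (C D : Category) (F : Functor C D) :
  naturally_full F <-> exists p : hom_family F, natural_family p /\ sections p.
Proof.
rewrite <- exists_natural_family.
split; intros [P HP]; exists P.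
- exact (proj1 (set_nat_trans_eq _ _) HP).
- apply set_nat_trans_eq; exact HP.
Qed.

Lemma semiseparableE (C D : Category) (F : Functor C D) :
  semiseparable F <-> exists p : hom_family F, natural_family p /\ regular p.
Proof.
rewrite <- exists_natural_family.
split; intros [P HP]; exists P.
- exact (proj1 (set_nat_trans_eq _ _) HP).
- apply set_nat_trans_eq; exact HP.
Qed.

(** * Duality *)

Lemma exists_family_opposite (C D : Category) (F : Functor C D)
  (S : hom_family F -> Prop) (S' : hom_family (oppositeF F) -> Prop) :
  (forall p : hom_family F, S p <-> S' (fun X Y => p Y X)) ->
  (exists p, natural_family p /\ S p) <-> (exists p, natural_family p /\ S' p).
Proof.
intros SS'; split.
- intros [p [np Sp]]; exists (fun X Y => p Y X); split; [|apply SS'; exact Sp].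
  intros X X' Y Y' u v g; simpl; rewrite !comp_assoc; apply np.
- intros [p [np Sp]]; exists (fun X Y => p Y X); split; [|apply SS'; exact Sp].
  intros X X' Y Y' u v g; rewrite <- !comp_assoc.
  exact (np Y Y' X X' v u g).
Qed.

Lemma separable_opposite (C D : Category) (F : Functor C D) :
  separable F <-> separable (oppositeF F).
Proof.
rewrite !separableE; apply exists_family_opposite.
intros p; split; intros Hp X Y; exact (Hp Y X).
Qed.

Lemma naturally_full_opposite (C D : Category) (F : Functor C D) :
  naturally_full F <-> naturally_full (oppositeF F).
Proof.
rewrite !naturally_fullE; apply exists_family_opposite.
intros p; split; intros Hp X Y; exact (Hp Y X).
Qed.

Lemma semiseparable_opposite (C D : Category) (F : Functor C D) :
  semiseparable F <-> semiseparable (oppositeF F).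
Proof.
rewrite !semiseparableE; apply exists_family_opposite.
intros p; split; intros Hp X Y; exact (Hp Y X).
Qed.

(** Reversing arrows exchanges unit with counit and one triangle identity with the other. *)
Definition adjunction_opposite (C D : Category)
  (F : Functor C D) (G : Functor D C) (A : F -| G) :
  oppositeF G -| oppositeF F.
Proof.
unshelve refine (@Build_Adjunction (opposite D) (opposite C)
  (oppositeF G) (oppositeF F)
  (@Build_NatTrans (opposite D) (opposite D) (idF _)
     (compF (oppositeF F) (oppositeF G)) (fun Y : D => adj_counit A Y) _)
  (@Build_NatTrans (opposite C) (opposite C)
     (compF (oppositeF G) (oppositeF F)) (idF _)
     (fun X : C => adj_unit A X) _) _ _).
- intros X Y f; symmetry; exact (naturality (adj_counit A) f).
- intros X Y f; symmetry; exact (naturality (adj_unit A) f).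
- exact (adj_triangle_right A).
- exact (adj_triangle_left A).
Defined.

(* [adj_unit] and [adj_counit] with [idF] and [compF] unfolded in their types, so
   that rewriting matches the objects syntactically. *)
Definition unit_at (C D : Category) (F : Functor C D) (G : Functor D C)
  (A : F -| G) (X : C) : Hom X (G (F X)) := adj_unit A X.

Definition counit_at (C D : Category) (F : Functor C D) (G : Functor D C)
  (A : F -| G) (Y : D) : Hom (F (G Y)) Y := adj_counit A Y.

Lemma unit_natural (C D : Category) (F : Functor C D) (G : Functor D C)
  (A : F -| G) (X Y : C) (f : Hom X Y) :
  unit_at A Y \c f = fmap G (fmap F f) \c unit_at A X.
Proof. exact (naturality (adj_unit A) f). Qed.

Lemma counit_natural (C D : Category) (F : Functor C D) (G : Functor D C)
  (A : F -| G) (X Y : D) (f : Hom X Y) :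
  counit_at A Y \c fmap F (fmap G f) = f \c counit_at A X.
Proof. exact (naturality (adj_counit A) f). Qed.

Lemma triangle_left (C D : Category) (F : Functor C D) (G : Functor D C)
  (A : F -| G) (X : C) :
  counit_at A (F X) \c fmap F (unit_at A X) = idm (F X).
Proof. exact (adj_triangle_left A X). Qed.

Lemma triangle_right (C D : Category) (F : Functor C D) (G : Functor D C)
  (A : F -| G) (Y : D) :
  fmap G (counit_at A Y) \c unit_at A (G Y) = idm (G Y).
Proof. exact (adj_triangle_right A Y). Qed.

(** * The family carried from [F] to [H] *)

Definition nu (C D : Category) (F : Functor C D) (G : Functor D C)
  (A : F -| G) (p : hom_family F) (X : C) : Hom (G (F X)) X :=
  p (G (F X)) X (counit_at A (F X)).

(** Two transposes in a row: [nu] becomes a map from [F X] to [H X] under [G -| H], then one from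
    [X] to [G (H X)] under [F -| G]. *)
Definition gamma (C D : Category) (F H : Functor C D) (G : Functor D C)
  (A : F -| G) (B : G -| H) (p : hom_family F) (X : C) : Hom X (G (H X)) :=
  fmap G (fmap H (nu A p X) \c unit_at B (F X)) \c unit_at A X.

Definition right_family (C D : Category) (F H : Functor C D) (G : Functor D C)
  (A : F -| G) (B : G -| H) (p : hom_family F) : hom_family H :=
  fun X Y g => counit_at B Y \c fmap G g \c gamma A B p X.

Lemma nu_natural (C D : Category) (F : Functor C D) (G : Functor D C)
  (A : F -| G) (p : hom_family F) (X Y : C) (f : Hom X Y) :
  natural_family p -> nu A p Y \c fmap G (fmap F f) = f \c nu A p X.
Proof.
intros np; unfold nu.
(* Naturality in each variable separately: both sides are the value of [p] at
   [fmap F f \c counit_at A (F X)]. *)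
pose proof (np _ _ _ _ (fmap G (fmap F f)) (idm Y) (counit_at A (F Y))) as El.
pose proof (np _ _ _ _ (idm (G (F X))) f (counit_at A (F X))) as Er.
rewrite fmap_id, !comp_idl, counit_natural in El.
rewrite fmap_id, !comp_idr in Er.
rewrite <- El; exact Er.
Qed.

Lemma gamma_natural (C D : Category) (F H : Functor C D) (G : Functor D C)
  (A : F -| G) (B : G -| H) (p : hom_family F) (X Y : C) (f : Hom X Y) :
  natural_family p ->
  gamma A B p Y \c f = fmap G (fmap H f) \c gamma A B p X.
Proof.
intros np; unfold gamma.
rewrite <- comp_assoc, unit_natural, !comp_assoc, <- !fmap_comp.
rewrite <- comp_assoc, unit_natural, !comp_assoc, <- !fmap_comp.
rewrite nu_natural by exact np; reflexivity.
Qed.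

Lemma right_family_natural (C D : Category) (F H : Functor C D)
  (G : Functor D C) (A : F -| G) (B : G -| H) (p : hom_family F) :
  natural_family p -> natural_family (right_family A B p).
Proof.
intros np X X' Y Y' u v g; unfold right_family.
rewrite !fmap_comp, !comp_assoc, counit_natural.
rewrite <- !comp_assoc, gamma_natural by exact np; reflexivity.
Qed.

(** A triangle identity inserts [counit_at A (F X) \c fmap F (unit_at A X)] after [fmap F f] in the
    argument of [p]; naturality then pulls out [f] and the unit. *)
Lemma family_fmap (C D : Category) (F : Functor C D) (G : Functor D C)
  (A : F -| G) (p : hom_family F) (X Y : C) (f : Hom X Y) :
  natural_family p -> p X Y (fmap F f) = f \c (nu A p X \c unit_at A X).
Proof.
intros np; unfold nu.
rewrite comp_assoc, <- np, <- comp_assoc, triangle_left, comp_idr.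
reflexivity.
Qed.

Lemma counit_gamma (C D : Category) (F H : Functor C D) (G : Functor D C)
  (A : F -| G) (B : G -| H) (p : hom_family F) (X : C) :
  counit_at B X \c gamma A B p X = nu A p X \c unit_at A X.
Proof.
unfold gamma.
rewrite fmap_comp, !comp_assoc, counit_natural.
rewrite <- (comp_assoc (nu A p X)), triangle_left, comp_idr; reflexivity.
Qed.

Lemma right_family_fmap (C D : Category) (F H : Functor C D)
  (G : Functor D C) (A : F -| G) (B : G -| H) (p : hom_family F)
  (X Y : C) (f : Hom X Y) :
  natural_family p -> right_family A B p (fmap H f) = p X Y (fmap F f).
Proof.
intros np; unfold right_family.
rewrite counit_natural, <- comp_assoc, counit_gamma.
symmetry; apply family_fmap; exact np.
Qed.

(** * Transfer of the three properties *)

Lemma fmap_id_transfer (C D : Category) (F H : Functor C D)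
  (G : Functor D C) (A : F -| G) (B : G -| H) (e : forall X : C, Hom X X) :
  (forall (X Y : C) (f : Hom X Y), e Y \c f = f \c e X) ->
  (forall X : C, fmap F (e X) = idm (F X)) ->
  forall X : C, fmap H (e X) = idm (H X).
Proof.
intros ne Fe X.
(* The unit at [G Z] is a split monomorphism, and by naturality it carries [e (G Z)] to
   [fmap G (fmap F (e (G Z)))], an identity. *)
assert (eG : forall Z : D, e (G Z) = idm (G Z)).
{ intros Z.
  rewrite <- (comp_idl (e (G Z))), <- (triangle_right A Z).
  rewrite <- comp_assoc, unit_natural, Fe, fmap_id, comp_idl.
  reflexivity. }
(* [H X] is a retract of [H (G (H X))], where [e] is already trivial by [eG]. *)
rewrite <- (comp_idr (fmap H (e X))), <- (triangle_right B X).
rewrite comp_assoc, <- fmap_comp, ne, eG, comp_idr; reflexivity.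
Qed.

Lemma right_family_regular (C D : Category) (F H : Functor C D)
  (G : Functor D C) (A : F -| G) (B : G -| H) (p : hom_family F) :
  natural_family p -> regular p -> regular (right_family A B p).
Proof.
intros np rp X Y f.
rewrite right_family_fmap, (family_fmap A), fmap_comp by exact np.
rewrite (fmap_id_transfer A B (e := fun X => nu A p X \c unit_at A X)).
- apply comp_idr.
- intros Z W h.
  rewrite <- comp_assoc, unit_natural, comp_assoc, nu_natural by exact np.
  symmetry; apply comp_assoc.
(* This endomorphism is the value of [p] at [fmap F (idm Z)], so regularity at [idm Z] applies. *)
- intros Z; rewrite <- (comp_idl (nu A p Z \c unit_at A Z)).
  rewrite <- family_fmap, rp by exact np; apply fmap_id.
Qed.

Lemma unit_nu (C D : Category) (F : Functor C D) (G : Functor D C)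
  (A : F -| G) (p : hom_family F) (X : C) :
  sections p -> unit_at A X \c nu A p X = idm (G (F X)).
Proof.
intros sp.
rewrite unit_natural; unfold nu; rewrite sp; apply triangle_right.
Qed.

(** The unit at [G Z] has [nu] as a right inverse and [fmap G (counit_at A Z)] as a left inverse, so
    the two agree. *)
Lemma nu_right_adjoint (C D : Category) (F : Functor C D) (G : Functor D C)
  (A : F -| G) (p : hom_family F) (Z : D) :
  sections p -> nu A p (G Z) = fmap G (counit_at A Z).
Proof.
intros sp.
rewrite <- (comp_idl (nu A p (G Z))), <- (triangle_right A Z).
rewrite <- comp_assoc, unit_nu, comp_idr by exact sp; reflexivity.
Qed.

Lemma gamma_counit (C D : Category) (F H : Functor C D) (G : Functor D C)
  (A : F -| G) (B : G -| H) (p : hom_family F) (X : C) :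
  natural_family p -> sections p ->
  gamma A B p X \c counit_at B X = idm (G (H X)).
Proof.
intros np sp.
(* This moves [gamma] to the object [G (H X)], where [nu] is known and [gamma] collapses to
   [fmap G (unit_at B (H X))]. *)
rewrite gamma_natural by exact np; unfold gamma.
rewrite nu_right_adjoint by exact sp.
rewrite <- unit_natural, fmap_comp, <- comp_assoc, triangle_right.
rewrite comp_idr, <- fmap_comp, triangle_right; apply fmap_id.
Qed.

Lemma right_family_sections (C D : Category) (F H : Functor C D)
  (G : Functor D C) (A : F -| G) (B : G -| H) (p : hom_family F) :
  natural_family p -> sections p -> sections (right_family A B p).
Proof.
intros np sp X Y g; unfold right_family.
(* The inserted identity brings [counit_at B X] next to [gamma], which it cancels. *)
rewrite <- (comp_idr (fmap H _)), <- (triangle_right B X).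
rewrite comp_assoc, <- fmap_comp, <- comp_assoc, gamma_counit by assumption.
rewrite comp_idr, fmap_comp, <- comp_assoc, <- unit_natural.
rewrite comp_assoc, triangle_right; apply comp_idl.
Qed.

Lemma left_to_right (C D : Category) (F H : Functor C D) (G : Functor D C)
  (A : F -| G) (B : G -| H) :
  (semiseparable F -> semiseparable H) /\
  (separable F -> separable H) /\
  (naturally_full F -> naturally_full H).
Proof.
rewrite !semiseparableE, !separableE, !naturally_fullE.
repeat split; intros [p [np Sp]]; exists (right_family A B p);
  (split; [apply right_family_natural; exact np|]).
- apply right_family_regular; assumption.
- intros X Y f; rewrite right_family_fmap by exact np; apply Sp.
- apply right_family_sections; assumption.
Qed.

Theorem proposition2p19 (C D : Category)
  (F H : Functor C D) (G : Functor D C)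
  (adjFG : F -| G) (adjGH : G -| H) :
  (semiseparable F <-> semiseparable H) /\
  (separable F <-> separable H) /\
  (naturally_full F <-> naturally_full H).
Proof.
destruct (left_to_right adjFG adjGH) as [ss [s nf]].
destruct (left_to_right (adjunction_opposite adjGH) (adjunction_opposite adjFG))
  as [ss' [s' nf']].
rewrite <- !semiseparable_opposite in ss'.
rewrite <- !separable_opposite in s'.
rewrite <- !naturally_full_opposite in nf'.
repeat split; assumption.
Qed.
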